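(* Let $n \ge 1$ be an integer. There exists an algebraic representation $\mathbf{A} = (A, F)$ of the lattice $M_n$ such that $A$ has $n+2$ elements and $F$ consists of $\frac{n(n+1)}{2} + 1$ functions.
   Context: An algebraic structure is a pair $\mathbf{A} = (A, F)$ where $A$ is a set and $F$ is a set of functions (operations), each of the form $f : A^m \to A$ for some $m \in \mathbb{N} \cup \{0\}$ (the arity $m$ may depend on $f$; a nullary operation, $m=0$, is a distinguished constant in $A$). A subalgebra of $\mathbf{A}$ is a subset $B \subseteq A$ closed under every operation in $F$ (in particular containing every nullary constant), with the restricted operations. The subalgebras of $\mathbf{A}$, ordered by set inclusion, form a lattice $\mathbf{Sub}(\mathbf{A})$. An algebraic representation of a lattice $L$ is an algebraic structure $\mathbf{A}$ such that $\mathbf{Sub}(\mathbf{A})$ is isomorphic to $L$ as a lattice. The lattice $M_n$ has $n+2$ elements: a least element $0$, a greatest element $1$, and $n$ pairwise incomparable elements $a_1, \dots, a_n$ strictly between $0$ and $1$. *)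

(* Defs.v *)
From HB Require Import structures.
From mathcomp Require Import all_boot all_order.
From mathcomp Require Import boolp classical_sets functions cardinality.

Set Implicit Arguments.
Unset Strict Implicit.
Unset Printing Implicit Defensive.
Import Order.TTheory.
Local Open Scope classical_set_scope.
Local Open Scope order_scope.

Definition isomorphic_lattices d1 (L1 : latticeType d1)
    d2 (L2 : latticeType d2) : Prop :=
  exists f : {lmorphism L1 -> L2}, bijective f.

(* The arity is part of the data of an operation, so operations of different
   arities are distinct; an operation of arity 0 is a distinguished constant. *)
Definition operation (A : Type) : Type := {m : nat & ('I_m -> A) -> A}.

Record algebra : Type := Algebra {
  carrier :> Type;
  operations : set (operation carrier) }.
Arguments operations : clear implicits.

Definition closed_under (A : Type) (f : operation A) (B : set A) : Prop :=
  forall x : 'I_(projT1 f) -> A, (forall i, B (x i)) -> B (projT2 f x).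

(* The empty set is a subuniverse exactly when there is no constant. *)
Definition is_subuniverse (A : algebra) (B : set A) : Prop :=
  forall f, operations A f -> closed_under f B.

Record subalgebra (A : algebra) : Type := Subalgebra {
  subuniverse :> set A;
  subuniverseP : `[< is_subuniverse subuniverse >] }.

HB.instance Definition _ (A : algebra) := [isSub for @subuniverse A].
HB.instance Definition _ (A : algebra) := [Choice of subalgebra A by <:].
HB.instance Definition _ (A : algebra) :=
  [SubChoice_isSubPOrder of subalgebra A by <: with set_display].

Section SubalgebraLattice.
Variable A : algebra.
Implicit Types B C D : subalgebra A.

Lemma Sub_leP B C : reflect (subuniverse B `<=` subuniverse C) (B <= C).
Proof. exact: asboolP. Qed.

Lemma subuniverse_closed B : is_subuniverse (subuniverse B).
Proof. exact/asboolP/subuniverseP. Qed.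

Lemma subuniverseI B C :
  `[< is_subuniverse (subuniverse B `&` subuniverse C) >].
Proof.
apply/asboolP => f Ff x xBC; split.
- by apply: (subuniverse_closed (B := B) Ff) => i; case: (xBC i).
- by apply: (subuniverse_closed (B := C) Ff) => i; case: (xBC i).
Qed.

Lemma subuniverse_generated (G : set A) :
  `[< is_subuniverse (smallest (@is_subuniverse A) G) >].
Proof.
apply/asboolP => f Ff x xG D [subD GD].
by apply: (subD f Ff) => i; apply: xG.
Qed.

Definition Sub_meet B C : subalgebra A := Subalgebra (subuniverseI B C).

Definition Sub_join B C : subalgebra A :=
  Subalgebra (subuniverse_generated (subuniverse B `|` subuniverse C)).

Lemma Sub_meetP B C D : (B <= Sub_meet C D) = (B <= C) && (B <= D).
Proof.
apply/Sub_leP/andP => [BCD|[/Sub_leP BC /Sub_leP BD]].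
- by split; apply/Sub_leP => x Bx; case: (BCD x Bx).
- by move=> x Bx; split; [exact: BC|exact: BD].
Qed.

Lemma Sub_joinP B C D : (Sub_join B C <= D) = (B <= D) && (C <= D).
Proof.
apply/Sub_leP/andP => [BCD|[/Sub_leP BD /Sub_leP CD]].
- by split; apply/Sub_leP => x xBC; apply: BCD; apply: sub_gen_smallest; [left|right].
- apply: smallest_sub; first exact: subuniverse_closed.
  by move=> x [/BD|/CD].
Qed.

HB.instance Definition _ :=
  Order.POrder_MeetJoin_isLattice.Build set_display (subalgebra A)
    Sub_meetP Sub_joinP.

End SubalgebraLattice.

Definition algebraic_representation (A : algebra)
    d (L : latticeType d) : Prop :=
  isomorphic_lattices (subalgebra A) L.

Inductive M (n : nat) : Type :=
  | Mbot
  | Mtop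
  | Matom of 'I_n.

Arguments Mbot {n}.
Arguments Mtop {n}.
Arguments Matom {n} i.

Section MLattice.
Variable n : nat.
Implicit Types x y z : M n.

Definition M_to_option x : option (option 'I_n) :=
  match x with
  | Mbot => None
  | Mtop => Some None
  | Matom i => Some (Some i)
  end.

Definition M_of_option (o : option (option 'I_n)) : M n :=
  match o with
  | None => Mbot
  | Some None => Mtop
  | Some (Some i) => Matom i
  end.

Lemma M_to_optionK : cancel M_to_option M_of_option.
Proof. by case. Qed.

HB.instance Definition _ := Finite.copy (M n) (can_type M_to_optionK).

Lemma card_M : #|{: M n}| = n.+2.
Proof.
rewrite -[RHS](_ : #|{: option (option 'I_n)}| = _); last first.
  by rewrite !card_option card_ord.
apply: (bij_eq_card (f := M_to_option)).
by exists M_of_option; [exact: M_to_optionK|case=> [[]|]].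
Qed.

Definition M_le x y : bool :=
  match x, y with
  | Mbot, _ => true
  | _, Mtop => true
  | Matom i, Matom j => i == j
  | _, _ => false
  end.

Lemma M_le_refl : reflexive M_le.
Proof. by case=> //= i; exact: eqxx. Qed.

Lemma M_le_anti : antisymmetric M_le.
Proof. by case=> [||i] [||j] //= /andP[/eqP->]. Qed.

Lemma M_le_trans : transitive M_le.
Proof. by case=> [||i] [||j] [||k] //= /eqP->. Qed.

Fact M_display : Order.disp_t. Proof. by []. Qed.

HB.instance Definition _ :=
  Order.Le_isPOrder.Build M_display (M n) M_le_refl M_le_anti M_le_trans.

Definition M_meet x y : M n :=
  match x, y with
  | Mbot, _ | _, Mbot => Mbot
  | Mtop, z | z, Mtop => z
  | Matom i, Matom j => if i == j then Matom i else Mbot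
  end.

Definition M_join x y : M n :=
  match x, y with
  | Mtop, _ | _, Mtop => Mtop
  | Mbot, z | z, Mbot => z
  | Matom i, Matom j => if i == j then Matom i else Mtop
  end.

Lemma M_meetP x y z : (x <= M_meet y z) = (x <= y) && (x <= z).
Proof.
rewrite /Order.le /=; case: x y z => [||i] [||j] [||k] //=; rewrite ?andbT ?andbF //.
  by case: ifP.
case: (altP (j =P k)) => [->|jk] /=; first by rewrite andbb.
by apply/esym/negbTE; apply: contra jk => /andP[/eqP<- /eqP<-].
Qed.

Lemma M_joinP x y z : (M_join x y <= z) = (x <= z) && (y <= z).
Proof.
rewrite /Order.le /=; case: x y z => [||i] [||j] [||k] //=; rewrite ?andbT ?andbF //.
- by case: ifP.
- by case: ifP.
case: (altP (i =P j)) => [->|ij] /=; first by rewrite andbb.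
by apply/esym/negbTE; apply: contra ij => /andP[/eqP-> /eqP->].
Qed.

HB.instance Definition _ :=
  Order.POrder_MeetJoin_isLattice.Build M_display (M n) M_meetP M_joinP.

End MLattice.

(* Main.v *)
Require Import Defs.
From mathcomp Require Import all_boot all_order.
From mathcomp Require Import boolp classical_sets functions cardinality.
From HB Require Import structures.
From Stdlib Require Import Eqdep_dec.
Import Order.TTheory.
Local Open Scope classical_set_scope.
Local Open Scope card_scope.

(** The carrier is [M n] itself, with operations chosen so that the
    subuniverses are exactly the principal ideals [{y | y <= x}]; since an
    element is determined by its principal ideal, monotonically in both
    directions, the lattice of subuniverses is then [M n].

    A principal ideal is a set that contains the bottom, contains with the top
    every atom, and contains with any two atoms the top. Each of these
    requirements is imposed by one operation per instance: the constant
    bottom; for each atom [i], a unary operation sending the top to [i]; for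
    each pair of atoms, a binary operation sending that pair to the top. All
    other values are the bottom, which every subuniverse contains anyway, so
    that no further closure condition arises ([subuniverse_is_downset],
    [downset_subuniverse]). These operations are pairwise distinct
    ([op_inj]) and number
    [1 + n + 'C(n, 2) = 1 + 'C(n.+1, 2) = n * (n + 1) / 2 + 1]. *)

(** Meets and joins are determined by the order, so an inverse of a surjective
    order embedding preserves them. *)
Lemma order_embedding_isomorphic {d1 d2 : Order.disp_t}
    {L1 : latticeType d1} {L2 : latticeType d2} (g : L2 -> L1) :
  (forall x y, (g x <= g y)%O = (x <= y)%O) -> (forall B, exists x, g x = B) ->
  isomorphic_lattices L1 L2.
Proof.
move=> g_le /choice[f fK].
have gK : cancel g f.
  by move=> x; apply/le_anti; rewrite -!g_le fK lexx.
have f_le B C : (f B <= f C)%O = (B <= C)%O by rewrite -g_le !fK.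
have f_meet : {morph f : B C / (B `&` C)%O}.
  move=> B C; apply/le_anti; rewrite lexI !f_le leIl leIr /=.
  by rewrite -g_le fK lexI -!f_le !gK leIl leIr.
have f_join : {morph f : B C / (B `|` C)%O}.
  move=> B C; apply/le_anti; rewrite leUx !f_le leUl leUr !andbT.
  by rewrite -[leRHS]gK f_le leUx -!f_le !gK leUl leUr.
have f_homo : {homo f : B C / (B <= C)%O} by move=> B C; rewrite f_le.
pose mo := Order.isOrderMorphism.Build d1 L1 d2 L2 f f_homo.
pose f0 : {omorphism L1 -> L2} := HB.pack f mo.
pose ml := Order.isLatticeMorphism.Build d1 L1 d2 L2 f0 f_meet f_join.
pose F : {lmorphism L1 -> L2} := HB.pack f mo ml.
by exists F; exists g.
Qed.

Lemma card_setT_fintype (T : finType) : [set: T] #= `I_#|T|.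
Proof.
apply/card_set_bijP; exists (fun x : T => enum_rank x : nat); split.
- by move=> x _; exact: ltn_ord.
- by move=> x y _ _ /ord_inj /enum_rank_inj.
- by move=> k kT; exists (enum_val (Ordinal kT)); rewrite ?enum_valK.
Qed.

(** The pairs of atoms are unordered, hence encoded as two-element sets: this
    gives one binary operation per pair. *)
Definition op_index (n : nat) : finType :=
  option ('I_n + {P : {set 'I_n} | #|P| == 2})%type.

Definition op {n : nat} (k : op_index n) : operation (M n) :=
  match k with
  | None => existT _ 0 (fun _ => Mbot)
  | Some (inl i) =>
      existT _ 1 (fun x => if x ord0 == Mtop then Matom i else Mbot)
  | Some (inr P) =>
      existT _ 2 (fun x =>
        if [forall i in val P, exists k, x k == Matom i] then Mtop else Mbot)
  end.

Definition M_algebra (n : nat) : algebra := Algebra (range (@op n)).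

Lemma card_op_index (n : nat) : #|op_index n| = (n * (n + 1)) %/ 2 + 1.
Proof.
rewrite card_option card_sum card_ord card_sig.
have -> : #|[pred P : {set 'I_n} | #|P| == 2]| = 'C(n, 2).
  by rewrite -[n in RHS]card_ord -card_draws cardsE.
by rewrite -[n in n + _]bin1 addnC -binS bin2 mulnC divn2 !addn1.
Qed.

Definition pair_args {n : nat} (a b : 'I_n) (k : 'I_2) : M n :=
  if k == ord0 then Matom a else Matom b.

Lemma pair_args_cover {n : nat} (a b : 'I_n) :
  [forall i in [set a; b]%SET, exists k, pair_args a b k == Matom i].
Proof.
apply/forall_inP => i; rewrite !inE => /orP[] /eqP->; apply/existsP.
  by exists ord0.
by exists ord_max.
Qed.

Lemma operation_fun_inj {T : Type} {m : nat} (f g : ('I_m -> T) -> T) :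
  existT (fun k => ('I_k -> T) -> T) m f = existT _ m g -> f = g.
Proof. exact: (inj_pair2_eq_dec nat (@eq_comparable nat)). Qed.

(** Applied to the two elements of a pair [P], the operation of a pair [P']
    yields the top just when [P'] is included in [P], that is, as both have
    two elements, when [P' = P]. *)
Lemma op_inj (n : nat) : injective (@op n).
Proof.
move=> [[i|[P cP]]|] [[j|[P' cP']]|] //= e; move: (congr1 (@projT1 _ _) e) => //= _.
- move/operation_fun_inj: e.
  by move/(congr1 (fun f => f (fun=> Mtop))) => /= -[->].
- move/operation_fun_inj: e => e.
  congr (Some (inr _)); apply: val_inj => /=.
  apply/esym/eqP; rewrite eqEcard (eqP cP) (eqP cP') leqnn andbT.
  have /cards2P[a [b [_ Pab]]] := cP.
  move/(congr1 (fun f => f (pair_args a b))): e; rewrite Pab pair_args_cover.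
  case: ifP => // /forall_inP P'x _; apply/fintype.subsetP => i /P'x /existsP[k].
  by rewrite /pair_args !inE; case: ifP => _ /eqP[->]; rewrite eqxx ?orbT.
Qed.

Definition downset {n : nat} (x : M n) : set (M n) := [set y | (y <= x)%O].

(** The only default value is the bottom, so an operation can leave an ideal
    only through its distinguished value. For a pair of atoms this would
    require both of them to lie below a single atom. *)
Lemma downset_subuniverse (n : nat) (z : M n) :
  @is_subuniverse (M_algebra n) (downset z).
Proof.
move=> _ [k _ <-] x; case: k x => [[i|[P cP]]|] //= x zx; rewrite /downset /=.
- by case: eqP => // xT; move: (zx ord0); rewrite /downset /= xT; case: z {zx}.
- case: ifP => // /forall_inP Px.
  have below i : i \in P -> (Matom i <= z)%O.
    by move=> /Px /existsP[k /eqP xk]; move: (zx k); rewrite /downset /= xk.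
  have /cards2P[a [b [ab Pab]]] := cP.
  have := below a; have := below b; rewrite Pab !inE !eqxx orbT => /(_ isT).
  case: z {zx below} => // j /eqP bj /(_ isT) /eqP aj.
  by rewrite aj bj eqxx in ab.
Qed.

Lemma subuniverse_is_downset (n : nat) (B : set (M n)) :
  @is_subuniverse (M_algebra n) B -> exists z, downset z = B.
Proof.
move=> subB.
have closedB k : closed_under (op k) B by apply: subB; exists k.
have Bbot : B Mbot by apply: (closedB None (fun=> Mbot)) => -[].
have Batom i : B Mtop -> B (Matom i).
  by move=> BT; have := closedB (Some (inl i)) (fun=> Mtop) (fun=> BT).
have Btop a b : a != b -> B (Matom a) -> B (Matom b) -> B Mtop.
  move=> ab Ba Bb; have cP : #|[set a; b]%SET| == 2 by rewrite cards2 ab.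
  pose P : {P : {set 'I_n} | #|P| == 2} := exist _ [set a; b]%SET cP.
  have := closedB (Some (inr P)) (pair_args a b).
  by rewrite /= pair_args_cover; apply => k; rewrite /pair_args; case: ifP.
have [BT|nBT] := pselect (B Mtop).
  by exists Mtop; apply/seteqP; split => [] [||i] // _; exact: Batom.
have [[i Bi]|nB] := pselect (exists i, B (Matom i)).
  exists (Matom i); apply/seteqP; split => [] [||j] //= Bj.
    by move/eqP: Bj => ->.
  by apply/eqP; apply: contra_notP nBT => /eqP ji; exact: Btop ji Bj Bi.
exists Mbot; apply/seteqP; split => [] [||i] //= Bi.
by case: nB; exists i.
Qed.

Definition downset_subalgebra {n : nat} (z : M n) : subalgebra (M_algebra n) :=
  @Subalgebra (M_algebra n) (downset z) (asboolT (downset_subuniverse n z)).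

Lemma M_algebra_representation (n : nat) :
  algebraic_representation (M_algebra n) (M n).
Proof.
apply: (order_embedding_isomorphic downset_subalgebra) => [x y|B].
  apply/Sub_leP/idP => [|xy z zx]; first by apply; exact: lexx.
  exact: le_trans zx xy.
have [z zB] := subuniverse_is_downset n B (subuniverse_closed (B := B)).
by exists z; apply: val_inj.
Qed.

Theorem proposition4 (n : nat) (hn : (1 <= n)%N) :
  exists A : algebra,
    [/\ algebraic_representation A (M n),
        [set: A] #= `I_(n + 2) &
        operations A #= `I_((n * (n + 1)) %/ 2 + 1)].
Proof.
exists (M_algebra n); split; first exact: M_algebra_representation.
- by rewrite addn2 -(card_M n); exact: card_setT_fintype.
- rewrite -card_op_index -(card_eqr (card_setT_fintype _)).
  by apply: inj_card_eq => k l _ _; exact: op_inj.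
Qed.
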